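(* Let $M$ be an $n$-dimensional smooth manifold and let $HM$ be a parallelizable distribution of rank $k<n$ on $M$ with parallelization sections $X_1,\dots,X_k$. Let $g$ be the sub-Riemannian metric on $HM$ for which $X_1,\dots,X_k$ are orthonormal, let $G$ be a Riemannian metric on $M$ extending $g$, let $VM=(HM)^\perp$ be the $G$-orthogonal complement of $HM$ in $TM$, and let $h:TM\to HM$ be the projector along $VM$. Then there exists a unique linear connection $\overset{\circ}{\nabla}:\mathfrak{X}(M)\times\Gamma(HM)\to\Gamma(HM)$ on $HM$ such that, with $\overset{\circ}{T}$ denoting its torsion tensor, (a) $\overset{\circ}{\nabla}$ is metric: $(\overset{\circ}{\nabla}_W g)(Y,Z)=0$ for all $Y,Z\in\Gamma(HM)$, $W\in\mathfrak{X}(M)$; (b) $\overset{\circ}{T}(Y,Z)=0$ for all $Y,Z\in\Gamma(HM)$; (c) $g(\overset{\circ}{T}(V,Y),Z)=g(\overset{\circ}{T}(V,Z),Y)$ for all $Y,Z\in\Gamma(HM)$, $V\in\Gamma(VM)$.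
   Context: $\mathfrak{X}(M)$ is the $C^\infty(M)$-module of smooth vector fields on $M$; $\Gamma(D)$ is the $C^\infty(M)$-module of smooth sections of a subbundle $D\subset TM$. A distribution of rank $k$ on $M$ is a smooth rank-$k$ vector subbundle of $TM$. A distribution $HM$ of rank $k<n$ is parallelizable if it admits $k$ global smooth sections $X_1,\dots,X_k\in\Gamma(HM)$ that are linearly independent at every point (parallelization sections), so $HM=\mathrm{span}\{X_1,\dots,X_k\}$. The parallelization forms $\Omega_i:\Gamma(HM)\to C^\infty(M)$ are the $C^\infty(M)$-linear maps with $\Omega_i(X_j)=\delta_{ij}$, and the metric is $g=\sum_{i=1}^k\Omega_i\otimes\Omega_i$, so $g(X_i,X_j)=\delta_{ij}$. A metric extension $G$ of $g$ is fixed, giving the $G$-orthogonal splitting $TM=HM\oplus VM$ and the $C^\infty(M)$-linear projectors $h:TM\to HM$, $v:TM\to VM$ with $h+v=\mathrm{id}_{TM}$, $h^2=h$, $v^2=v$, $h\circ v=v\circ h=0$. A linear connection on $HM$ is a linear connection $\nabla:\mathfrak{X}(M)\times\Gamma(HM)\to\Gamma(HM)$ on the vector bundle $HM\to M$. Its torsion tensor is the map $T:\mathfrak{X}(M)\times\mathfrak{X}(M)\to\Gamma(HM)$, $$T(Y,Z)=\nabla_Y(hZ)-\nabla_Z(hY)-h[Y,Z],$$ and $(\nabla_Wg)(Y,Z)=W\cdot g(Y,Z)-g(\nabla_WY,Z)-g(Y,\nabla_WZ)$ for $Y,Z\in\Gamma(HM)$. *)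

(* Defs.v *)
From HB Require Import structures.
From mathcomp Require Import all_boot all_order all_algebra.
From mathcomp Require Import all_classical all_reals.
From mathcomp Require Import topology normedtype derive.
From mathcomp Require Import ring.

Set Implicit Arguments.
Unset Strict Implicit.
Unset Printing Implicit Defensive.

Import Order.TTheory GRing.Theory Num.Theory.
Import numFieldNormedType.Exports.

Local Open Scope classical_set_scope.
Local Open Scope ring_scope.

Section EuclideanSmoothness.
Context {R : realType} {n : nat}.
Implicit Types (U : set 'rV[R]_n) (f g : 'rV[R]_n -> R).

(* Only meaningful for open U: continuity and partial derivatives are taken in
   the ambient space. *)
Fixpoint Ck_on (k : nat) U f : Prop :=
  {in U, continuous f} /\
  if k is k'.+1 then
    forall i : 'I_n,
      (forall x, U x -> derivable f x (delta_mx 0 i)) /\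
      Ck_on k' U ('D_(delta_mx 0 i) f)
  else True.

Definition smooth_on U f : Prop := forall k, Ck_on k U f.

Lemma Ck_on_cont k U f : Ck_on k U f -> {in U, continuous f}.
Proof. by case: k => [|k] []. Qed.

Lemma Ck_onW k U f : Ck_on k.+1 U f -> Ck_on k U f.
Proof.
elim: k f => [|k IH] f; first by case.
move=> [cf df]; split=> // i; have [dfi Dfi] := df i.
by split=> //; exact: IH.
Qed.

Lemma Ck_on_ext k U f g : open U -> (forall x, U x -> f x = g x) ->
  Ck_on k U f -> Ck_on k U g.
Proof.
move=> oU; elim: k f g => [|k IH] f g fg fk.
all: have nU x : U x -> nbhs x U by move=> Ux; exact: open_nbhs_nbhs.
all: have nfg x : U x -> \near x, f x = g x by
  move=> /nU; apply: (filterS fg).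
all: have cg : {in U, continuous g} by
  move=> x /[dup] /set_mem Ux xU; rewrite /continuous_at -(fg _ Ux);
  exact: (cvg_trans (near_eq_cvg (nfg x Ux)) (Ck_on_cont fk xU)).
  by [].
split=> // i; have [_ /(_ i)[dfi Dfi]] := fk; split=> [x Ux|].
  by apply: near_eq_derivable (dfi x Ux); exact: nfg.
by apply: IH Dfi => x Ux; apply: near_eq_derive; exact: nfg.
Qed.

Lemma Ck_on_cst k U (a : R) : open U -> Ck_on k U (cst a).
Proof.
move=> oU; elim: k a => [|k IH] a.
all: have ca : {in U, continuous (cst a : 'rV[R]_n -> R)}.
1,3: by move=> x _; exact: cst_continuous.
  by [].
split=> // i; split=> [x _|]; first exact: derivable_cst.
by apply: Ck_on_ext (IH 0) => // x _; rewrite derive_cst.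
Qed.

Lemma Ck_onD k U f g : open U -> Ck_on k U f -> Ck_on k U g ->
  Ck_on k U (f + g).
Proof.
move=> oU; elim: k f g => [|k IH] f g fk gk.
all: have [cf cg] := (Ck_on_cont fk, Ck_on_cont gk).
all: split=> //; first by move=> x xU; exact: (cvgD (cf x xU) (cg x xU)).
move=> i; have [[_ /(_ i)[df Df]] [_ /(_ i)[dg Dg]]] := (fk, gk).
split=> [x Ux|]; first by apply: derivableD; [exact: df|exact: dg].
by apply: Ck_on_ext (IH _ _ Df Dg) => // x Ux; rewrite deriveD//;
  [exact: df|exact: dg].
Qed.

Lemma Ck_onM k U f g : open U -> Ck_on k U f -> Ck_on k U g ->
  Ck_on k U (f * g).
Proof.
move=> oU; elim: k f g => [|k IH] f g fk gk.
all: have [cf cg] := (Ck_on_cont fk, Ck_on_cont gk).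
all: split=> //; first by move=> x xU; exact: (cvgM (cf x xU) (cg x xU)).
move=> i; have [[_ /(_ i)[df Df]] [_ /(_ i)[dg Dg]]] := (fk, gk).
split=> [x Ux|]; first by apply: derivableM; [exact: df|exact: dg].
have fDg := IH _ _ (Ck_onW fk) Dg; have gDf := IH _ _ (Ck_onW gk) Df.
by apply: Ck_on_ext (Ck_onD oU fDg gDf) => // x Ux; rewrite deriveM//;
  [exact: df|exact: dg].
Qed.

End EuclideanSmoothness.

Record chart (R : realType) (n : nat) (M : topologicalType) := Chart {
  chart_dom : set M;
  chart_map :> M -> 'rV[R]_n;
  chart_inv : 'rV[R]_n -> M;
  chart_dom_open : open chart_dom;
  chart_img_open : open (chart_map @` chart_dom);
  chartK : {in chart_dom, cancel chart_map chart_inv};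
  chart_continuous : {in chart_dom, continuous chart_map};
  chart_inv_continuous : {in chart_map @` chart_dom, continuous chart_inv}
}.

Definition smoothly_compatible (R : realType) (n : nat) (M : topologicalType)
    (c c' : chart R n M) : Prop :=
  forall i : 'I_n,
    smooth_on (c @` (chart_dom c `&` chart_dom c'))
              (fun x => c' (chart_inv c x) 0 i).

(* The atlas need not be maximal: the smooth functions below are the same for
   it and for the maximal atlas it generates. *)
Record smoothManifold (R : realType) (n : nat) := SmoothManifold {
  manifold_space :> topologicalType;
  manifold_hausdorff : hausdorff_space manifold_space;
  manifold_second_countable : @second_countable manifold_space;
  atlas : set (chart R n manifold_space);
  atlas_cover : forall p, exists2 c, atlas c & chart_dom c p;
  atlas_compatible : forall c c', atlas c -> atlas c' ->
    smoothly_compatible c c'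
}.

Section SmoothFunctions.
Context {R : realType} {n : nat} (M : smoothManifold R n).

Definition manifold_smooth_on (U : set M) (f : M -> R) : Prop :=
  forall c, atlas c -> smooth_on (c @` (U `&` chart_dom c)) (f \o chart_inv c).

Definition smooth_fun : {pred M -> R} :=
  fun f => `[< manifold_smooth_on setT f >].

Lemma smooth_fun_subring : subring_closed smooth_fun.
Proof.
have oM (c : chart R n M) : open (c @` (setT `&` chart_dom c)).
  by rewrite setTI; exact: chart_img_open.
have sN (f : M -> R) : f \in smooth_fun -> - f \in smooth_fun.
  move=> /asboolP sf; apply/asboolP => c Ac k.
  have := Ck_onM (oM c) (Ck_on_cst k (-1) (oM c)) (sf c Ac k).
  by apply: Ck_on_ext (oM c) _ => x _; rewrite -[LHS]/(-1 * _) mulN1r.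
split.
- by apply/asboolP => c _ k; exact: Ck_on_cst (oM c).
- move=> f g sf /sN sg; move/asboolP: sf => sf; move/asboolP: sg => sg.
  by apply/asboolP => c Ac k; exact: Ck_onD (oM c) (sf c Ac k) (sg c Ac k).
- move=> f g /asboolP sf /asboolP sg.
  by apply/asboolP => c Ac k; exact: Ck_onM (oM c) (sf c Ac k) (sg c Ac k).
Qed.

HB.instance Definition _ :=
  GRing.isSubringClosed.Build (M -> R) smooth_fun smooth_fun_subring.

Lemma smooth_fun_cst (a : R) : cst a \in smooth_fun.
Proof.
apply/asboolP => c _ k; apply: Ck_on_cst.
by rewrite setTI; exact: chart_img_open.
Qed.

Lemma smooth_fun_scaler : GRing.scaler_closed (smooth_fun : {pred M -> R^o}).
Proof. by move=> a f; exact: (rpredM (smooth_fun_cst a)). Qed.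

HB.instance Definition _ :=
  GRing.isScaleClosed.Build R (M -> R^o) smooth_fun smooth_fun_scaler.

Record Cinf := MkCinf { Cinf_fun :> M -> R; _ : Cinf_fun \in smooth_fun }.

HB.instance Definition _ := [isSub for Cinf_fun].
HB.instance Definition _ := [Choice of Cinf by <:].
HB.instance Definition _ :=
  GRing.SubChoice_isSubComPzRing.Build (M -> R) smooth_fun Cinf
    smooth_fun_subring.
HB.instance Definition _ := [SubZmodule_isSubLmodule of Cinf by <:].

End SmoothFunctions.

Section TangentSpace.
Context {R : realType} {n : nat} {M : smoothManifold R n} (p : M).

Definition derivation_at : {pred Cinf M -> R^o} := fun v =>
  `[< (forall (a : R) (f g : Cinf M), v (a *: f + g) = a * v f + v g) /\
      (forall f g : Cinf M, v (f * g) = v f * g p + f p * v g) >].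

Lemma derivation_at_submod : submod_closed derivation_at.
Proof.
split; first by apply/asboolP; split=> *;
  rewrite -![(0 : Cinf M -> R^o) _]/(0 : R) ?mulr0 ?mul0r addr0.
move=> b u v /asboolP[ul uM] /asboolP[vl vM]; apply/asboolP.
have E f : (b *: u + v) f = b * u f + v f by [].
split=> [a f g|f g]; rewrite !E ?ul ?vl ?uM ?vM.
  by rewrite !mulrDr addrACA !mulrA (mulrC b a).
by rewrite !(mulrDl, mulrDr) addrACA !mulrA (mulrC b (f p)).
Qed.

HB.instance Definition _ := GRing.isSubmodClosed.Build R (Cinf M -> R^o)
  derivation_at derivation_at_submod.

Record tangent := MkTangent {
  tangent_fun :> Cinf M -> R^o;
  _ : tangent_fun \in derivation_at }.

HB.instance Definition _ := [isSub for tangent_fun].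
HB.instance Definition _ := [Choice of tangent by <:].
HB.instance Definition _ := [SubChoice_isSubLmodule of tangent by <:].

Lemma tangentP (v : tangent) (a : R) (f g : Cinf M) :
  v (a *: f + g) = a * v f + v g.
Proof. by case: v => v /= /asboolP[]. Qed.

Lemma tangentM (v : tangent) (f g : Cinf M) : v (f * g) = v f * g p + f p * v g.
Proof. by case: v => v /= /asboolP[]. Qed.

Lemma tangent_eq (u v : tangent) : u =1 v -> u = v.
Proof. by move=> uv; apply/val_inj/funext. Qed.

End TangentSpace.

Arguments tangent {R n} M p.

Section VectorFields.
Context {R : realType} {n : nat} (M : smoothManifold R n).

(* This agrees with smoothness as a section of the tangent bundle: a field of
   derivations is smooth iff it maps smooth functions to smooth functions. *)
Record vector_field := VectorField {
  vf_at :> forall p : M, tangent M p;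
  vf_smooth : forall f : Cinf M, (fun p => vf_at p f) \in @smooth_fun _ _ M
}.

HB.instance Definition _ := gen_eqMixin vector_field.
HB.instance Definition _ := gen_choiceMixin vector_field.

Lemma vector_field_eq (X Y : vector_field) :
  (forall p (f : Cinf M), X p f = Y p f) -> X = Y.
Proof.
case: X Y => [X sX] [Y sY] /= XY.
have eXY : X = Y by apply: functional_extensionality_dep => p; exact/tangent_eq.
by rewrite eXY in sX *; congr VectorField; exact: Prop_irrelevance.
Qed.

Definition vf_act (X : vector_field) (f : Cinf M) : Cinf M :=
  MkCinf (vf_smooth X f).

Program Definition vf_zero : vector_field := @VectorField (fun p => 0) _.
Next Obligation. by move=> f; exact: (rpred0 (@smooth_fun _ _ M)). Qed.

Program Definition vf_opp (X : vector_field) : vector_field :=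
  @VectorField (fun p => - X p) _.
Next Obligation. by move=> X f; exact: (rpredNr (vf_smooth X f)). Qed.

Program Definition vf_add (X Y : vector_field) : vector_field :=
  @VectorField (fun p => X p + Y p) _.
Next Obligation.
by move=> X Y f; exact: (rpredD (vf_smooth X f) (vf_smooth Y f)).
Qed.

Program Definition vf_scale (f : Cinf M) (X : vector_field) : vector_field :=
  @VectorField (fun p => f p *: X p) _.
Next Obligation.
by move=> f X g; exact: (rpredM (valP f) (vf_smooth X g)).
Qed.

Lemma vf_addA : associative vf_add.
Proof. by move=> X Y Z; apply: vector_field_eq => p f; exact: addrA. Qed.

Lemma vf_addC : commutative vf_add.
Proof. by move=> X Y; apply: vector_field_eq => p f; exact: addrC. Qed.

Lemma vf_add0 : left_id vf_zero vf_add.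
Proof. by move=> X; apply: vector_field_eq => p f; exact: add0r. Qed.

Lemma vf_addN : left_inverse vf_zero vf_opp vf_add.
Proof. by move=> X; apply: vector_field_eq => p f; exact: addNr. Qed.

HB.instance Definition _ :=
  GRing.isZmodule.Build vector_field vf_addA vf_addC vf_add0 vf_addN.

Lemma vf_scaleA (f g : Cinf M) (X : vector_field) :
  vf_scale f (vf_scale g X) = vf_scale (f * g) X.
Proof. by apply: vector_field_eq => p k; exact: mulrA. Qed.

Lemma vf_scale1 : left_id 1 vf_scale.
Proof. by move=> X; apply: vector_field_eq => p k; exact: mul1r. Qed.

Lemma vf_scaleDr : right_distributive vf_scale +%R.
Proof. by move=> f X Y; apply: vector_field_eq => p k; exact: mulrDr. Qed.

Lemma vf_scaleDl (X : vector_field) : {morph vf_scale^~ X : f g / f + g}.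
Proof. by move=> f g; apply: vector_field_eq => p k; exact: mulrDl. Qed.

HB.instance Definition _ := GRing.Zmodule_isLmodule.Build (Cinf M) vector_field
  vf_scaleA vf_scale1 vf_scaleDr vf_scaleDl.

Lemma lie_bracket_derivation (X Y : vector_field) (p : M) :
  (fun f : Cinf M => X p (vf_act Y f) - Y p (vf_act X f))
    \in derivation_at p.
Proof.
have actP (Z : vector_field) (a : R) (f g : Cinf M) :
    vf_act Z (a *: f + g) = a *: vf_act Z f + vf_act Z g.
  by apply/val_inj/funext => q /=; exact: tangentP.
have actM (Z : vector_field) (f g : Cinf M) :
    vf_act Z (f * g) = 1 *: (vf_act Z f * g) + f * vf_act Z g.
  by rewrite scale1r; apply/val_inj/funext => q /=; exact: tangentM.
apply/asboolP; split=> [a f g|f g].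
  by rewrite !actP !tangentP mulrBr opprD addrACA.
rewrite !actM !tangentP !tangentM.
rewrite -![vf_act _ _ p]/(vf_at _ p _).
ring.
Qed.

Lemma lie_bracket_smooth (X Y : vector_field) (f : Cinf M) :
  (fun p => MkTangent (lie_bracket_derivation X Y p) f) \in @smooth_fun _ _ M.
Proof.
exact: (rpredB (vf_smooth X (vf_act Y f)) (vf_smooth Y (vf_act X f))).
Qed.

Definition lie_bracket (X Y : vector_field) : vector_field :=
  @VectorField (fun p => MkTangent (lie_bracket_derivation X Y p))
    (lie_bracket_smooth X Y).

End VectorFields.

Section Distributions.
Context {R : realType} {n : nat} (M : smoothManifold R n).

Definition lin_indep (V : lmodType R) (k : nat) (e : 'I_k -> V) : Prop :=
  forall a : 'I_k -> R, \sum_i a i *: e i = 0 -> forall i, a i = 0.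

Definition lin_span (V : lmodType R) (k : nat) (e : 'I_k -> V) : set V :=
  range (fun a : 'I_k -> R => \sum_i a i *: e i).

(* A local vector field on an open U is given by derivations of global smooth
   functions; using bump functions, its smoothness may be tested on these. *)
Record distribution (k : nat) := Distribution {
  dist_fiber :> forall p : M, set (tangent M p);
  dist_frame : forall p : M, exists U : set M,
    exists E : 'I_k -> forall q : M, tangent M q,
    [/\ open U, U p,
        forall i (f : Cinf M), manifold_smooth_on U (fun q => E i q f),
        forall q, U q -> lin_indep (fun i => E i q) &
        forall q, U q -> @dist_fiber q = lin_span (fun i => E i q)]
}.

Definition is_section (D : forall p : M, set (tangent M p))
    (Y : vector_field M) : Prop := forall p, D p (Y p).

Section Sections.
Context {k : nat} (HM : distribution k).

Definition section_pred : {pred vector_field M} :=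
  fun Y => `[< is_section HM Y >].

Lemma section_submod : submod_closed section_pred.
Proof.
have H p : exists e : 'I_k -> tangent M p, HM p = lin_span e.
  have [U [E [_ Up _ _ /(_ p Up) ->]]] := dist_frame HM p.
  by exists (fun i => E i p).
split; first apply/asboolP => p; last move=> f Y Z /asboolP sY /asboolP sZ;
  last apply/asboolP => p; have [e He] := H p.
  rewrite He; exists (fun=> 0) => //.
  by under eq_bigr do rewrite scale0r; rewrite big1.
have := (sY p, sZ p); rewrite He => -[[a _ aY] [b _ bZ]].
exists (fun i => f p * a i + b i) => //.
under eq_bigr do rewrite scalerDl -scalerA.
by rewrite big_split -scaler_sumr aY bZ.
Qed.

HB.instance Definition _ :=
  GRing.isSubmodClosed.Build (Cinf M) (vector_field M) section_pred
    section_submod.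

Record Gamma := MkGamma {
  Gamma_field :> vector_field M;
  _ : Gamma_field \in section_pred }.

HB.instance Definition _ := [isSub for Gamma_field].
HB.instance Definition _ := [Choice of Gamma by <:].
HB.instance Definition _ := [SubChoice_isSubLmodule of Gamma by <:].

Definition parallelization (X : 'I_k -> Gamma) : Prop :=
  forall p, lin_indep (fun i => X i p).

Definition parallelization_forms (X : 'I_k -> Gamma)
    (Omega : 'I_k -> {linear Gamma -> (Cinf M)^o}) : Prop :=
  forall i j, Omega i (X j) = (i == j)%:R.

Definition par_metric (Omega : 'I_k -> {linear Gamma -> (Cinf M)^o})
    (Y Z : Gamma) : Cinf M :=
  \sum_i (Omega i Y : Cinf M) * (Omega i Z : Cinf M).

End Sections.

Record riemannian_metric := RiemannianMetric {
  rm_form :> forall p : M, tangent M p -> tangent M p -> R;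
  rm_linear : forall p (a : R) (u v w : tangent M p),
    rm_form (a *: u + v) w = a * rm_form u w + rm_form v w;
  rm_sym : forall p (u v : tangent M p), rm_form u v = rm_form v u;
  rm_pos : forall p (u : tangent M p), u != 0 -> 0 < rm_form u u;
  rm_smooth : forall Y Z : vector_field M,
    (fun p => rm_form (Y p) (Z p)) \in @smooth_fun _ _ M
}.

Definition orth_compl (G : riemannian_metric)
    (D : forall p : M, set (tangent M p)) (p : M) : set (tangent M p) :=
  [set v | forall u, D p u -> G p u v = 0].

Section Connections.
Context {k : nat} {HM : distribution k}.
Implicit Types (g : Gamma HM -> Gamma HM -> Cinf M)
  (h : {linear vector_field M -> Gamma HM})
  (nabla : vector_field M -> Gamma HM -> Gamma HM).

Definition metric_extension (G : riemannian_metric) g : Prop :=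
  forall (Y Z : Gamma HM) p, G p (Y p) (Z p) = g Y Z p.

Definition projector_along (VM : forall p : M, set (tangent M p)) h : Prop :=
  (forall Y : Gamma HM, h Y = Y) /\ (forall V, is_section VM V -> h V = 0).

Definition linear_connection nabla : Prop :=
  [/\ forall Y f W W', nabla (f *: W + W') Y = f *: nabla W Y + nabla W' Y,
      forall W Y Z, nabla W (Y + Z) = nabla W Y + nabla W Z &
      forall W f Y, nabla W (f *: Y) = vf_act W f *: Y + f *: nabla W Y].

Definition torsion h nabla (Y Z : vector_field M) : Gamma HM :=
  nabla Y (h Z) - nabla Z (h Y) - h (lie_bracket Y Z).

Definition nabla_metric g nabla (W : vector_field M) (Y Z : Gamma HM) :
    Cinf M :=
  vf_act W (g Y Z) - g (nabla W Y) Z - g Y (nabla W Z).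

End Connections.

End Distributions.

(* Main.v *)
Require Import Defs.
From HB Require Import structures.
From mathcomp Require Import all_boot all_order all_algebra.
From mathcomp Require Import all_classical all_reals.
From mathcomp Require Import topology normedtype derive.
From mathcomp Require Import ring.

Set Implicit Arguments.
Unset Strict Implicit.
Unset Printing Implicit Defensive.

Import Order.TTheory GRing.Theory Num.Theory.

Local Open Scope ring_scope.

(** Write [h] for the projector onto the distribution and consider, for a vector
    field [W] and sections [Y], [Z] of the distribution, the Koszul expression

      K(W, Y, Z) = W g(Y, Z) + Y g(hW, Z) - Z g(hW, Y)
                   + g(h[W, Y], Z) - g(h[Y, Z], hW) - g(h[W, Z], Y).

    When [W] is horizontal this is the classical Koszul expression of the
    projected bracket; when [W] is vertical ([hW = 0]) only
    W g(Y, Z) + g(h[W, Y], Z) - g(h[W, Z], Y) remains.  For a linear connection,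
    being metric, having no torsion on horizontal pairs and having symmetric
    mixed torsion are together equivalent to the single formula
    2 g(nabla_W Y, Z) = K(W, Y, Z): on horizontal [W] it is the usual
    Levi-Civita computation, on vertical [W] it combines metricity with the
    symmetry of the mixed torsion, and every [W] is the sum of [hW] and the
    vertical field [W - hW].
    The two directions are [koszul_formula] and [koszul_adapted].

    Uniqueness follows since [g] is nondegenerate.  For existence, [K] is linear
    over the smooth functions in [Z] ([koszulZr]), and the global orthonormal
    frame represents any such linear form as g(Y', -) ([par_metric_riesz]).
    That [W - hW] is vertical ([vertical_part]) is seen by constructing the
    G-orthogonal projection of [W] on the frame and checking that [h] agrees
    with it. *)

(** * Smooth functions, vector fields and the Lie bracket *)

Section Fields.
Context {R : realType} {n : nat} {M : smoothManifold R n}.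
Implicit Types (f a b : Cinf M) (W X Y Z : vector_field M).

Lemma Cinf_eq a b : (forall p, a p = b p) -> a = b.
Proof. by move=> ab; apply/val_inj/funext. Qed.

(** The constant function 1/2. *)
Definition Cinf_half : Cinf M := MkCinf (smooth_fun_cst M (2^-1)).

Lemma Cinf_halfD : Cinf_half + Cinf_half = 1.
Proof. by apply: Cinf_eq => p; rewrite [RHS](splitr (1 : R)) mul1r. Qed.

Lemma Cinf_double_eq0 a : a + a = 0 -> a = 0.
Proof. by move=> a0; rewrite -[a]mul1r -Cinf_halfD mulrDl -mulrDr a0 mulr0. Qed.

Lemma vf_actDl W X a : vf_act (W + X) a = vf_act W a + vf_act X a.
Proof. exact: Cinf_eq. Qed.

Lemma vf_actZl f W a : vf_act (f *: W) a = f * vf_act W a.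
Proof. exact: Cinf_eq. Qed.

Lemma vf_actD W a b : vf_act W (a + b) = vf_act W a + vf_act W b.
Proof.
by apply: Cinf_eq => p; have := tangentP (W p) 1 a b; rewrite mul1r scale1r.
Qed.

Lemma vf_act0 W : vf_act W 0 = 0.
Proof. by apply: (addrI (vf_act W 0)); rewrite -vf_actD !addr0. Qed.

Lemma vf_actM W a b : vf_act W (a * b) = vf_act W a * b + a * vf_act W b.
Proof. by apply: Cinf_eq => p; exact: tangentM. Qed.

Lemma lie_bracketC X Y : lie_bracket X Y = - lie_bracket Y X.
Proof. by apply: vector_field_eq => p f; rewrite -[LHS]opprB. Qed.

Lemma lie_bracketDl X Y Z :
  lie_bracket (X + Y) Z = lie_bracket X Z + lie_bracket Y Z.
Proof.
apply: vector_field_eq => p f.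
rewrite -[LHS]/((X p (vf_act Z f) + Y p (vf_act Z f))
  - vf_act Z (vf_act (X + Y) f) p) vf_actDl vf_actD.
by rewrite -[(_ + _ : Cinf M) p]/(_ p + _ p) opprD addrACA.
Qed.

Lemma lie_bracketZl f X Y :
  lie_bracket (f *: X) Y = f *: lie_bracket X Y - vf_act Y f *: X.
Proof.
apply: vector_field_eq => p a.
rewrite -[LHS]/(f p * X p (vf_act Y a) - vf_act Y (vf_act (f *: X) a) p).
rewrite vf_actZl vf_actM.
rewrite -[RHS]/(f p * (X p (vf_act Y a) - Y p (vf_act X a))
  - Y p f * X p a) -[(_ + _ : Cinf M) p]/(Y p f * X p a + f p * Y p (vf_act X a)).
by rewrite mulrBr opprD addrA addrAC.
Qed.

Lemma lie_bracketDr X Y Z :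
  lie_bracket X (Y + Z) = lie_bracket X Y + lie_bracket X Z.
Proof. by rewrite lie_bracketC lie_bracketDl opprD -!(lie_bracketC X). Qed.

Lemma lie_bracketZr f X Y :
  lie_bracket X (f *: Y) = f *: lie_bracket X Y + vf_act X f *: Y.
Proof.
by rewrite lie_bracketC lie_bracketZl opprB addrC (lie_bracketC X) scalerN.
Qed.

End Fields.


(** * The Koszul formula

    Here [g] is any symmetric bilinear form on sections, over the ring of smooth
    functions, and [h] any linear projector onto the sections; definiteness of
    [g] and a complement annihilated by [h] come in only for the
    characterization of the connection. *)

Section Koszul.
Context {R : realType} {n k : nat} {M : smoothManifold R n}.
Context {HM : distribution M k}.
Context {h : {linear vector_field M -> Gamma HM}}.
Context {g : Gamma HM -> Gamma HM -> Cinf M}.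
Context (h_id : forall Y : Gamma HM, h Y = Y).
Context (gP : forall (f : Cinf M) (Y Y' Z : Gamma HM),
  g (f *: Y + Y') Z = f * g Y Z + g Y' Z).
Context (gC : forall Y Z : Gamma HM, g Y Z = g Z Y).
Implicit Types (f : Cinf M) (W X : vector_field M) (Y Z U : Gamma HM).
Implicit Types nabla : vector_field M -> Gamma HM -> Gamma HM.

Lemma metricDl Y Z U : g (Y + Z) U = g Y U + g Z U.
Proof. by have := gP 1 Y Z U; rewrite scale1r mul1r. Qed.

Lemma metric0l U : g 0 U = 0.
Proof. by apply: (addrI (g 0 U)); rewrite -metricDl !addr0. Qed.

Lemma metricZl f Y U : g (f *: Y) U = f * g Y U.
Proof. by have := gP f Y 0 U; rewrite metric0l !addr0. Qed.

Lemma metricNl Y U : g (- Y) U = - g Y U.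
Proof. by rewrite -scaleN1r metricZl mulN1r. Qed.

Lemma metricDr Y Z U : g U (Y + Z) = g U Y + g U Z.
Proof. by rewrite !(gC U) metricDl. Qed.

Lemma metricZr f Y U : g U (f *: Y) = f * g U Y.
Proof. by rewrite !(gC U) metricZl. Qed.

Lemma metricNr Y U : g U (- Y) = - g U Y.
Proof. by rewrite !(gC U) metricNl. Qed.

Let gE := (metricDl, metricZl, metricNl, metricDr, metricZr, metricNr).

(** The Koszul expression.  Inserting [h] in the first argument makes it
    meaningful for every vector field [W], not only for sections of the
    distribution. *)
Definition koszul W Y Z : Cinf M :=
  vf_act W (g Y Z) + vf_act Y (g (h W) Z) - vf_act Z (g (h W) Y)
  + g (h (lie_bracket W Y)) Z - g (h (lie_bracket Y Z)) (h W)
  - g (h (lie_bracket W Z)) Y.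

(* The additive and scaling structures on sections are those of the underlying
   vector fields. *)
Lemma GammaD Y Z : Gamma_field (Y + Z) = Gamma_field Y + Gamma_field Z.
Proof. by []. Qed.

Lemma GammaZ f Y : Gamma_field (f *: Y) = f *: Gamma_field Y.
Proof. by []. Qed.

Let vfE := (GammaD, GammaZ, @lie_bracketDl R n M, @lie_bracketDr R n M,
  @lie_bracketZl R n M, @lie_bracketZr R n M, @vf_actDl R n M,
  @vf_actZl R n M, @vf_actD R n M, @vf_actM R n M).
Let hZ f W : h (f *: W) = f *: h W. Proof. exact: linearZ. Qed.
Let hD W X : h (W + X) = h W + h X. Proof. exact: linearD. Qed.
Let hN W : h (- W) = - h W. Proof. exact: linearN. Qed.
Let hE := (hD, hZ, hN, h_id).

Lemma koszulP f W W' Y Z :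
  koszul (f *: W + W') Y Z = f * koszul W Y Z + koszul W' Y Z.
Proof.
rewrite /koszul !(vfE, hE, gE) (gC Y Z) (gC (h W) Y) (gC (h W) Z).
ring.
Qed.

Lemma koszulZr f W Y Z U :
  koszul W Y (f *: Z + U) = f * koszul W Y Z + koszul W Y U.
Proof.
rewrite /koszul !(vfE, hE, gE) (gC Y Z) (gC (h W) Y) (gC (h W) Z).
ring.
Qed.

Lemma koszulDm W Y Z U : koszul W (Y + Z) U = koszul W Y U + koszul W Z U.
Proof. rewrite /koszul !(vfE, hE, gE); ring. Qed.

(** In the middle argument [K] is a derivation up to the factor 2: this is the
    Leibniz rule of the connection that it defines. *)
Lemma koszulZm f W Y Z :
  koszul W (f *: Y) Z = f * koszul W Y Z + (vf_act W f * g Y Z) *+ 2.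
Proof.
rewrite /koszul !(vfE, hE, gE) (gC Y Z) (gC (h W) Y) (gC (h W) Z).
ring.
Qed.

(* [VM] is a complement of the distribution on which [h] vanishes. *)
Context {VM : forall p : M, set (tangent M p)}.
Context (h_vert : forall V, is_section VM V -> h V = 0).
Context (vert : forall W, is_section VM (W - h W)).
Context (g_ndeg : forall Y, g Y Y = 0 -> Y = 0).

Lemma metric_double_inj Y Y' :
  (forall Z, g Y Z *+ 2 = g Y' Z *+ 2) -> Y = Y'.
Proof.
move=> YY'; apply/eqP; rewrite -subr_eq0; apply/eqP/g_ndeg/Cinf_double_eq0.
by rewrite -mulr2n {1}metricDl metricNl mulrnBl YY' subrr.
Qed.

(** Linear connections that are metric, have no horizontal torsion, and whose
    mixed torsion Y |-> T(V, Y) is g-self-adjoint for vertical [V]. *)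
Definition adapted_connection nabla : Prop :=
  [/\ linear_connection nabla,
      forall W Y Z, nabla_metric g nabla W Y Z = 0,
      forall Y Z, torsion h nabla Y Z = 0 &
      forall Y Z V, is_section VM V ->
        g (torsion h nabla V Y) Z = g (torsion h nabla V Z) Y].

Lemma connection0 nabla : linear_connection nabla -> forall W, nabla W 0 = 0.
Proof.
by case=> _ nD _ W; apply: (addrI (nabla W 0)); rewrite -nD !addr0.
Qed.

Lemma koszul_formula nabla : adapted_connection nabla ->
  forall W Y Z, g (nabla W Y) Z *+ 2 = koszul W Y Z.
Proof.
move=> [conn nmet ntor nvert] W Y Z; have [nlin _ _] := conn.
have met V A B : vf_act V (g A B) = g (nabla V A) B + g A (nabla V B).
  by apply/eqP; rewrite -subr_eq0 opprD addrA; apply/eqP/nmet.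
have nD V V' A : nabla (V + V') A = nabla V A + nabla V' A.
  by have := nlin A 1 V V'; rewrite !scale1r.
have kD V V' : koszul (V + V') Y Z = koszul V Y Z + koszul V' Y Z.
  by have := koszulP 1 V V' Y Z; rewrite scale1r mul1r.
have tor (A B : Gamma HM) : h (lie_bracket A B) = nabla A B - nabla B A.
  by apply/eqP; rewrite eq_sym -subr_eq0; have := ntor A B;
    rewrite /torsion !h_id => ->.
(* Horizontal directions: the Levi-Civita computation. *)
have hor (A : Gamma HM) : g (nabla A Y) Z *+ 2 = koszul A Y Z.
  rewrite /koszul !h_id !tor !met !gE.
  by rewrite (gC Y (nabla A Z)) (gC A (nabla Y Z)) (gC A (nabla Z Y)); ring.
(* Vertical directions: metricity fixes the self-adjoint part of
   Y |-> nabla_V Y, and the torsion condition its skew part. *)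
have ver V : is_section VM V -> g (nabla V Y) Z *+ 2 = koszul V Y Z.
  move=> VV; have := nvert Y Z V VV.
  rewrite /torsion /koszul (h_vert VV) !h_id !(connection0 conn) !gE
    !(gC _ 0) !metric0l !vf_act0.
  move/(canRL (subrK _)).
  rewrite met (gC Y (nabla V Z)) !subr0 => ->; ring.
by rewrite -(subrK (Gamma_field (h W)) W) nD kD metricDl mulrnDl hor ver.
Qed.

Lemma koszul_adapted nabla :
  (forall W Y Z, g (nabla W Y) Z *+ 2 = koszul W Y Z) ->
  adapted_connection nabla.
Proof.
move=> nK; have conn : linear_connection nabla.
  split.
  - move=> Y f W W'; apply: metric_double_inj => Z.
    by rewrite gP mulrnDl -mulrnAr !nK koszulP.
  - move=> W Y Z; apply: metric_double_inj => U.
    by rewrite metricDl mulrnDl !nK koszulDm.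
  - move=> W f Y; apply: metric_double_inj => Z.
    rewrite gP metricZl nK koszulZm -nK; ring.
split=> //.
- move=> W Y Z; apply: Cinf_double_eq0; rewrite -mulr2n /nabla_metric.
  rewrite !mulrnBl nK (gC Y (nabla W Z)) nK /koszul (gC Z Y).
  rewrite (lie_bracketC Z) hN !gE; ring.
- move=> Y Z; apply: metric_double_inj => U.
  rewrite /torsion !h_id !gE !mulrnBl !nK metric0l /koszul !h_id.
  rewrite (lie_bracketC Z Y) hN !gE.
  by rewrite (gC Z Y); ring.
- move=> Y Z V VV; apply/eqP; rewrite -subr_eq0; apply/eqP/Cinf_double_eq0.
  rewrite -mulr2n mulrnBl /torsion !gE !mulrnBl !h_id (h_vert VV).
  rewrite !(connection0 conn) !metric0l !nK /koszul (h_vert VV).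
  by rewrite !(gC _ 0) !metric0l !vf_act0 (gC Z Y); ring.
Qed.

End Koszul.

(** * Orthonormal frames and the orthogonal complement *)

Section Frame.
Context {R : realType}.

(** [k] independent vectors in a space spanned by [k] vectors span it: the matrix
    expressing [e] in terms of [E] is invertible. *)
Lemma lin_indep_span (V : lmodType R) (k : nat) (E e : 'I_k -> V) :
  (forall i, lin_span E (e i)) -> lin_indep e ->
  forall v, lin_span E v -> lin_span e v.
Proof.
move=> eE e_indep v [b _ <-].
have {eE} [a aE] : exists a : 'I_k -> 'I_k -> R,
    forall i, \sum_j a i j *: E j = e i.
  suff /choice[a aE] : forall i, exists u : 'I_k -> R,
    \sum_j u j *: E j = e i by exists a.
  by move=> i; have [u _ uE] := eE i; exists u.
pose A := \matrix_(i, j) a i j : 'M[R]_k.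
have AE (c : 'rV[R]_k) :
    \sum_i c 0 i *: e i = \sum_j (c *m A) 0 j *: E j.
  under eq_bigr do rewrite -aE scaler_sumr.
  rewrite exchange_big; apply: eq_bigr => j _; rewrite mxE scaler_suml.
  by apply: eq_bigr => i _; rewrite mxE scalerA.
have A_unit : A \in unitmx.
  rewrite -row_free_unit; apply: inj_row_free => c cA0.
  apply/rowP => i; rewrite [RHS]mxE; apply: (e_indep (fun i => c 0 i)).
  by rewrite AE cA0 big1// => j _; rewrite mxE scale0r.
pose c := (\row_j b j) *m invmx A.
exists (fun i => c 0 i) => //; rewrite AE mulmxKV//.
by apply: eq_bigr => j _; rewrite mxE.
Qed.

Context {n k : nat} {M : smoothManifold R n} {HM : distribution M k}.
Context {X : 'I_k -> Gamma HM}.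
Context {Omega : 'I_k -> {linear Gamma HM -> (Cinf M)^o}}.
Context {G : riemannian_metric M}.
Context (X_par : parallelization X) (OmegaX : parallelization_forms X Omega).
Context (Gext : metric_extension G (par_metric Omega)).
Implicit Types (f : Cinf M) (W : vector_field M) (Y Z U : Gamma HM).

Let g := par_metric Omega.

Lemma par_metricP f Y Z U : g (f *: Y + Z) U = f * g Y U + g Z U.
Proof.
rewrite /g /par_metric mulr_sumr -big_split; apply: eq_bigr => i _ /=.
by rewrite linearP mulrDl -mulrA.
Qed.

Lemma par_metricC Y Z : g Y Z = g Z Y.
Proof. by apply: eq_bigr => i _; rewrite mulrC. Qed.

Lemma par_metric_ndeg Y : g Y Y = 0 -> Y = 0.
Proof.
move=> gY0; apply: val_inj; apply: vector_field_eq => p f.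
have [->//|/(rm_pos G)] := eqVneq (Y p) 0.
by rewrite Gext -/g gY0 ltxx.
Qed.

(** Orthonormality of the frame; it also identifies the parallelization forms as
    the metric duals of the frame sections. *)
Lemma par_metricX i Y : g (X i) Y = Omega i Y.
Proof.
rewrite /g /par_metric (bigD1 i)//= OmegaX eqxx mul1r big1 ?addr0// => j ji.
by rewrite OmegaX (negbTE ji) mul0r.
Qed.

Lemma par_expansion Y : Y = \sum_i (Omega i Y : Cinf M) *: X i.
Proof.
apply/eqP; rewrite -subr_eq0; apply/eqP/par_metric_ndeg.
rewrite /g /par_metric big1// => j _.
rewrite [Omega j _](_ : _ = 0) ?mul0r//.
rewrite linearB linear_sum (bigD1 j)//= linearZ OmegaX eqxx.
rewrite big1 ?addr0 => [|i ij]; last first.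
  by rewrite linearZ OmegaX eq_sym (negbTE ij); exact: mulr0.
by apply/eqP; rewrite subr_eq0 [X in _ == X]mulr1.
Qed.

(** Every linear form on sections is represented by a section. *)
Lemma par_metric_riesz (phi : Gamma HM -> Cinf M) :
    (forall f Y Z, phi (f *: Y + Z) = f * phi Y + phi Z) ->
  forall Z, g (\sum_i phi (X i) *: X i) Z = phi Z.
Proof.
move=> phiP Z.
have phiD Y U : phi (Y + U) = phi Y + phi U.
  by have := phiP 1 Y U; rewrite scale1r mul1r.
have phi0 : phi 0 = 0 by apply: (addrI (phi 0)); rewrite -phiD !addr0.
have phiZ f Y : phi (f *: Y) = f * phi Y.
  by have := phiP f Y 0; rewrite phi0 !addr0.
rewrite (big_morph (g^~ Z) (id1 := 0) (op1 := +%R)); first last.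
- exact: metric0l par_metricP Z.
- by move=> Y U; exact: metricDl par_metricP Y U Z.
rewrite [in RHS](par_expansion Z) (big_morph phi phiD phi0).
apply: eq_bigr => i _.
by rewrite phiZ (metricZl par_metricP) par_metricX mulrC.
Qed.

(** The frame spans each fibre of the distribution, so that orthogonality to a
    whole fibre can be tested on the frame ([rm_orth_section]). *)
Lemma dist_span (p : M) (u : tangent M p) :
  HM p u -> lin_span (fun i => X i p) u.
Proof.
have [U [E [_ Up _ _ /(_ p Up) HE]]] := dist_frame HM p.
have Xsec i : HM p (X i p) by have /asboolP := valP (X i); exact.
rewrite HE in Xsec *; exact: lin_indep_span Xsec (@X_par p) u.
Qed.

Lemma rmC p (u v : tangent M p) : G p u v = G p v u.
Proof. exact: rm_sym. Qed.

Lemma rmDl p (u v w : tangent M p) : G p (u + v) w = G p u w + G p v w.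
Proof. by have := rm_linear G 1 u v w; rewrite scale1r mul1r. Qed.

Lemma rm0l p (w : tangent M p) : G p 0 w = 0.
Proof. by apply: (addrI (G p 0 w)); rewrite -rmDl !addr0. Qed.

Lemma rmZl p (a : R) (u w : tangent M p) : G p (a *: u) w = a * G p u w.
Proof. by have := rm_linear G a u 0 w; rewrite rm0l !addr0. Qed.

Lemma rm_orth_section W :
  (forall i p, G p (X i p) (W p) = 0) -> is_section (orth_compl G HM) W.
Proof.
move=> XW p u /dist_span[a _ <-].
rewrite (big_morph (fun u => G p u (W p)) (id1 := 0) (op1 := +%R)); first last.
- exact: rm0l.
- by move=> v w; exact: rmDl.
by rewrite big1// => i _; rewrite rmZl XW mulr0.
Qed.

Context {h : {linear vector_field M -> Gamma HM}}.
Context (h_proj : projector_along (orth_compl G HM) h).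

(** The assumptions on [h] determine it on sections of the distribution and on
    vertical fields; the G-orthogonal projection [P] on the frame shows that
    these already add up to all vector fields. *)
Lemma vertical_part W : is_section (orth_compl G HM) (W - h W).
Proof.
pose c i : Cinf M := MkCinf (rm_smooth G W (X i)).
pose P : Gamma HM := \sum_i c i *: X i.
suff WP : is_section (orth_compl G HM) (W - P).
  suff -> : h W = P by [].
  have := h_proj.2 _ WP; rewrite linearB h_proj.1 => /eqP.
  by rewrite subr_eq0 => /eqP.
apply: rm_orth_section => i p; rewrite rmC.
rewrite -[X in G p X _]/(W p + (- P : vector_field M) p) rmDl.
have -> : (- P : vector_field M) p = -1 *: P p by rewrite scaleN1r.
rewrite rmZl mulN1r [X in _ - X]rmC Gext -/g par_metricX.
rewrite linear_sum (bigD1 i)//= linearZ OmegaX eqxx.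
rewrite big1 ?addr0 => [|j ji]; last first.
  by rewrite linearZ OmegaX eq_sym (negbTE ji); exact: mulr0.
by rewrite [X in Cinf_fun X]mulr1 subrr.
Qed.

End Frame.

Theorem theorem3p5 (R : realType) (n k : nat) (M : smoothManifold R n)
    (HM : distribution M k)
    (X : 'I_k -> Gamma HM)
    (Omega : 'I_k -> {linear Gamma HM -> (Cinf M)^o})
    (G : riemannian_metric M)
    (h : {linear vector_field M -> Gamma HM})
    (hkn : (k < n)%N)
    (hX : parallelization X)
    (hOmega : parallelization_forms X Omega)
    (hG : metric_extension G (par_metric Omega))
    (hh : projector_along (orth_compl G HM) h) :
  let g := par_metric Omega in
  exists! nabla : vector_field M -> Gamma HM -> Gamma HM,
    [/\ linear_connection nabla,
        forall (W : vector_field M) (Y Z : Gamma HM),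
          nabla_metric g nabla W Y Z = 0,
        forall Y Z : Gamma HM, torsion h nabla Y Z = 0 &
        forall (Y Z : Gamma HM) (V : vector_field M),
          is_section (orth_compl G HM) V ->
          g (torsion h nabla V Y) Z = g (torsion h nabla V Z) Y].
Proof.
move=> g; have [h_id h_vert] := hh.
have gP := @par_metricP R n k M HM Omega.
have gC := @par_metricC R n k M HM Omega.
have g_ndeg := par_metric_ndeg hG.
pose K := @koszul R n k M HM h g.
pose nabla W Y := \sum_i (Cinf_half * K W Y (X i)) *: X i.
have nablaK W Y Z : g (nabla W Y) Z *+ 2 = K W Y Z.
  have -> : g (nabla W Y) Z = Cinf_half * K W Y Z.
    apply: (par_metric_riesz hOmega hG (phi := fun U => Cinf_half * K W Y U)).
    by move=> f U U'; rewrite /K koszulZr// mulrDr mulrCA.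
  by rewrite mulr2n -mulrDl Cinf_halfD mul1r.
exists nabla; split; first exact: (koszul_adapted h_id gP gC h_vert g_ndeg).
move=> nabla' nabla'P; apply/funext => W; apply/funext => Y.
apply: (metric_double_inj gP g_ndeg) => Z; rewrite nablaK.
by rewrite (koszul_formula h_id gP gC h_vert (vertical_part hX hOmega hG hh)).
Qed.
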